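(* Suppose $G$ is a finite abelian group. Set $u=\sum_{g\in G} g\in\mathbb{Z}G$. Let $\mathcal Z_u$ denote the set of polynomials of the form $1+\sum_{i=1}^k c_i u t^i$ with each $c_i$ in $\mathbb{Z}$. Suppose $A$ and $B$ are square matrices over $\mathbb{Z}G$ such that $\det(I-tA)$ and $\det(I-tB)$ lie in $\mathcal Z_u$, and $\overline A$ and $\overline B$ are shift equivalent over $\mathbb{Z}$. Then $A$ and $B$ are shift equivalent over $\mathbb{Z}G$.
   Context: $\mathbb{Z}G$ is the integral group ring. $\overline A$ is the integer matrix obtained by applying the augmentation $\sum_g n_g g\mapsto\sum_g n_g$ to each entry of $A$. Square matrices $A,B$ (possibly of different sizes) are shift equivalent over a ring $\mathcal R$ if there are $\ell\in\mathbb{N}$ and matrices $R,S$ over $\mathcal R$ with $A^\ell=RS$, $B^\ell=SR$, $AR=RB$, $SA=BS$. *)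

(* Defs.v *)
From HB Require Import structures.
From mathcomp Require Import all_boot all_order all_algebra all_fingroup.

Set Implicit Arguments.
Unset Strict Implicit.
Unset Printing Implicit Defensive.

Import GRing.Theory.
Local Open Scope ring_scope.

(* A record rather than an alias of {ffun gT -> int}: the latter is already a
   ring canonically, but for the pointwise product, not for convolution. *)
Record ZG (gT : finGroupType) := MkZG { ZGcoef : {ffun gT -> int} }.
Arguments MkZG {gT}.
Arguments ZGcoef {gT}.

HB.instance Definition _ (gT : finGroupType) := [isNew for @ZGcoef gT].
HB.instance Definition _ (gT : finGroupType) := [Choice of ZG gT by <:].

Section GroupRing.
Variable gT : finGroupType.
Implicit Types (x y z : ZG gT) (g h : gT).

Definition ZG0 : ZG gT := MkZG [ffun=> 0].
Definition ZGopp x := MkZG [ffun g => - ZGcoef x g].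
Definition ZGadd x y := MkZG [ffun g => ZGcoef x g + ZGcoef y g].

Definition ZGelt g : ZG gT := MkZG [ffun h => (h == g)%:R].

Definition ZG1 := ZGelt 1%g.
Definition ZGmul x y :=
  MkZG [ffun g => \sum_h ZGcoef x h * ZGcoef y (h^-1 * g)%g].

Lemma ZGP x y : (forall g, ZGcoef x g = ZGcoef y g) -> x = y.
Proof. by move=> exy; apply: val_inj; apply/ffunP. Qed.

Fact ZGaddA : associative ZGadd.
Proof. by move=> x y z; apply: ZGP => g; rewrite !ffunE addrA. Qed.
Fact ZGaddC : commutative ZGadd.
Proof. by move=> x y; apply: ZGP => g; rewrite !ffunE addrC. Qed.
Fact ZGadd0 : left_id ZG0 ZGadd.
Proof. by move=> x; apply: ZGP => g; rewrite !ffunE add0r. Qed.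
Fact ZGaddN : left_inverse ZG0 ZGopp ZGadd.
Proof. by move=> x; apply: ZGP => g; rewrite !ffunE addNr. Qed.

HB.instance Definition _ :=
  GRing.isZmodule.Build (ZG gT) ZGaddA ZGaddC ZGadd0 ZGaddN.

Fact ZGmulA : associative ZGmul.
Proof.
move=> x y z; apply: ZGP => g; rewrite !ffunE.
under eq_bigr do rewrite ffunE big_distrr /=.
under [RHS]eq_bigr do rewrite ffunE big_distrl /=.
rewrite [RHS]exchange_big; apply: eq_bigr => h _ /=.
rewrite [RHS](reindex_inj (mulgI h)); apply: eq_bigr => k _ /=.
by rewrite mulKg mulrA invMg mulgA.
Qed.
Fact ZGmul1l : left_id ZG1 ZGmul.
Proof.
move=> x; apply: ZGP => g; rewrite !ffunE (bigD1 1%g) //= big1 => [|h nh1].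
  by rewrite ffunE eqxx mul1r invg1 mul1g addr0.
by rewrite ffunE (negPf nh1) mul0r.
Qed.
Fact ZGmul1r : right_id ZG1 ZGmul.
Proof.
move=> x; apply: ZGP => g; rewrite !ffunE (bigD1 g) //= big1 => [|h nhg].
  by rewrite ffunE mulVg eqxx mulr1 addr0.
by rewrite ffunE -eq_mulVg1 (negPf nhg) mulr0.
Qed.
Fact ZGmulDl : left_distributive ZGmul +%R.
Proof.
move=> x y z; apply: ZGP => g; rewrite !ffunE -big_split /=.
by apply: eq_bigr => h _; rewrite ffunE mulrDl.
Qed.
Fact ZGmulDr : right_distributive ZGmul +%R.
Proof.
move=> x y z; apply: ZGP => g; rewrite !ffunE -big_split /=.
by apply: eq_bigr => h _; rewrite ffunE mulrDr.
Qed.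
Fact ZG1_neq0 : ZG1 != 0.
Proof. by apply/eqP => /(congr1 (ZGcoef^~ 1%g)); rewrite !ffunE eqxx. Qed.

HB.instance Definition _ := GRing.Zmodule_isNzRing.Build (ZG gT)
  ZGmulA ZGmul1l ZGmul1r ZGmulDl ZGmulDr ZG1_neq0.

Lemma ZGmulC : abelian [set: gT] -> commutative (@GRing.mul (ZG gT)).
Proof.
move=> /centsP cGG x y; apply: ZGP => g; rewrite !ffunE.
rewrite (reindex_inj (mulgI g)) (reindex_inj invg_inj) /=.
apply: eq_bigr => h _.
by rewrite invMg invgK mulgKV mulrC (cGG g (in_setT _) _ (in_setT _)).
Qed.

Definition ZGaug x : int := \sum_g ZGcoef x g.

Definition ZGu : ZG gT := \sum_g ZGelt g.

Definition in_Zu (p : {poly ZG gT}) : Prop :=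
  exists (k : nat) (c : nat -> int),
    p = 1 + \sum_(1 <= i < k.+1) (ZGu *~ c i) *: 'X^i.

Fact ZGaug_zmod : zmod_morphism ZGaug.
Proof.
by move=> x y; rewrite -sumrB; apply: eq_bigr => g _; rewrite !ffunE.
Qed.
Fact ZGaug_monoid : monoid_morphism ZGaug.
Proof.
split=> [|x y].
  rewrite /ZGaug (bigD1 1%g) //= big1 => [|g ng1]; rewrite ffunE ?eqxx ?addr0 //.
  by rewrite (negPf ng1).
rewrite /ZGaug; under eq_bigr do rewrite ffunE.
rewrite exchange_big mulr_suml; apply: eq_bigr => h _ /=.
rewrite (reindex_inj (mulgI h)) mulr_sumr; apply: eq_bigr => g _.
by rewrite mulKg.
Qed.
HB.instance Definition _ :=
  GRing.isZmodMorphism.Build (ZG gT) int ZGaug ZGaug_zmod.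
HB.instance Definition _ :=
  GRing.isMonoidMorphism.Build (ZG gT) int ZGaug ZGaug_monoid.

End GroupRing.

Definition det_1_sub_t (K : nzRingType) (n : nat) (A : 'M[K]_n) : {poly K} :=
  \det (1%:M - 'X *: map_mx polyC A).

(* Requiring 0 < l is harmless: if A ^+ 0 = R *m S and B ^+ 0 = S *m R then
   (R, S *m A) satisfies the equations with l = 1. *)
Definition shift_equivalent (K : nzRingType) (m n : nat)
    (A : 'M[K]_m) (B : 'M[K]_n) : Prop :=
  exists (l : nat) (R : 'M[K]_(m, n)) (S : 'M[K]_(n, m)),
    [/\ (0 < l)%N, A ^+ l = R *m S, B ^+ l = S *m R,
        A *m R = R *m B & S *m A = B *m S].

(* Main.v *)
Require Import Defs.
From HB Require Import structures.
From mathcomp Require Import all_boot all_order all_algebra all_fingroup.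

(** The hypothesis on $\det(I-tA)$ says that it is congruent to 1 modulo the
    ideal generated by $u$, and this forces $A$ to be nilpotent modulo $u$: in
    $(I-tA)\,\mathrm{adj}(I-tA)=\det(I-tA)\,I$ the coefficients of the
    adjugate are congruent to the successive powers of $A$, while the
    adjugate, being a polynomial, has only finitely many nonzero coefficients
    ([expmx_dvd_of_det]).  So some power $A^k$, and every higher one, is
    divisible by $u$; likewise for $B$.

    Now $u x = \varepsilon(x) u$, where $\varepsilon$ is the augmentation, and
    $\varepsilon(u)=|G|$ is not zero in $\mathbb{Z}$; hence $\varepsilon$ is
    injective on the ideal $(u)$, and two matrices divisible by $u$ are equal
    as soon as their augmentations are.  Let $(R,S)$ be a shift equivalence of
    lag $\ell$ between the augmented matrices, and lift $R$ and $S$ arbitrarily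
    to $\tilde R,\tilde S$ over $\mathbb{Z}G$.  Then $A^k\tilde R$ and
    $\tilde S A^k$ form a shift equivalence of lag $\ell+2k$ for $k$ large: in
    each of the four equations both sides are divisible by $u$, and the
    augmented equations follow from those for $R$ and $S$.

    The argument is carried out for a surjective ring morphism out of a
    commutative ring which is injective on a principal ideal
    ([shift_equivalent_lift]); working over such an abstract ring also avoids
    the fact that the group ring is commutative only for abelian $G$. *)

Set Implicit Arguments.
Unset Strict Implicit.
Unset Printing Implicit Defensive.

Import GRing.Theory Num.Theory.
Local Open Scope ring_scope.

Lemma map_mxXn (K L : nzRingType) (f : {rmorphism K -> L}) n (A : 'M[K]_n) k :
  map_mx f (A ^+ k) = map_mx f A ^+ k.
Proof.
elim: k => [|k IHk]; first by rewrite !expr0 map_mx1.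
by rewrite !exprS map_mxM IHk.
Qed.

Section DivisibleMatrices.
Variables (K : comNzRingType) (u : K).

Definition dvdmx m n (X : 'M[K]_(m, n)) := exists M, X = u *: M.

Lemma dvdmx_mull m n p (X : 'M[K]_(m, n)) (Y : 'M[K]_(n, p)) :
  dvdmx Y -> dvdmx (X *m Y).
Proof. by case=> M ->; exists (X *m M); rewrite scalemxAr. Qed.

Lemma dvdmx_mulr m n p (X : 'M[K]_(m, n)) (Y : 'M[K]_(n, p)) :
  dvdmx X -> dvdmx (X *m Y).
Proof. by case=> M ->; exists (M *m Y); rewrite scalemxAl. Qed.

Lemma dvdmx_expr_le n (A : 'M[K]_n) j k :
  (j <= k)%N -> dvdmx (A ^+ j) -> dvdmx (A ^+ k).
Proof. by move=> /subnK <-; rewrite exprD; apply: dvdmx_mull. Qed.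

(** Comparing coefficients of $t^{j+1}$ in $(I-tA)D=\det(I-tA)I$, where $D$ is
    the adjugate, gives $D_{j+1}\equiv A D_j$ modulo $u$, whence
    $D_j\equiv A^j$; and $D_j$ vanishes for large $j$. *)
Lemma expmx_dvd_of_det n (A : 'M[K]_n) (q : {poly K}) :
  det_1_sub_t A = 1 + u *: q -> exists k, dvdmx (A ^+ k).
Proof.
rewrite /det_1_sub_t => detA; set P := 1%:M - _ in detA.
have := mul_mx_adj P; rewrite detA; move: (\adj P) => Q PQ.
pose D j : 'M[K]_n := \matrix_(a, b) (Q a b)`_j.
have PQE a b :
    Q a b - 'X * \sum_c (A a c)%:P * Q c b
    = (1 + u *: q) *+ (a == b).
  have /matrixP/(_ a b) := PQ; rewrite [RHS]mxE => <-.
  rewrite /P mulmxBl mul1mx -scalemxAl !mxE; congr (_ - _ * _).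
  by apply: eq_bigr => c _; rewrite mxE.
have D0 : D 0 = 1%:M + u *: (q`_0)%:M.
  apply/matrixP => a b; rewrite !mxE.
  have := congr1 (coefp 0) (PQE a b).
  rewrite /= coefB coefXM /= subr0 coefMn coefD coef1 coefZ /= => ->.
  by rewrite mulrnAr mulrnDl.
have DS j : D j.+1 = A *m D j + u *: (q`_j.+1)%:M.
  apply/matrixP => a b; rewrite !mxE.
  have := congr1 (coefp j.+1) (PQE a b).
  rewrite /= coefB coefXM /= coefMn coefD coef1 coefZ /= add0r => /eqP.
  rewrite subr_eq addrC => /eqP->; rewrite mulrnAr coef_sum; congr (_ + _).
  by apply: eq_bigr => c _; rewrite coefCM mxE.
have [M DE] : exists M : nat -> 'M[K]_n, forall j, D j = A ^+ j - u *: M j.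
  (* M is read off the recurrence satisfied by the A ^+ j - D j. *)
  pose M := fix M j := if j is i.+1 then A *m M i - (q`_j)%:M else - (q`_0)%:M.
  exists M; elim=> [|j IHj]; first by rewrite D0 /= scalerN opprK.
  rewrite DS IHj /= mulmxBr -scalemxAr exprS scalerBr opprB addrCA addrA.
  by rewrite addrC addrA [RHS]addrC addrA.
pose k := (\max_a \max_b size (Q a b))%N.
have Dk : D k = 0.
  apply/matrixP => a b; rewrite !mxE nth_default //.
  exact: leq_trans (leq_bigmax b) (leq_bigmax a).
by exists k, (M k); apply/eqP; rewrite -subr_eq0 -DE Dk.
Qed.

End DivisibleMatrices.

Section Lifting.
Variables (K : comNzRingType) (L : nzRingType) (f : {rmorphism K -> L}).
Variables (lift : L -> K) (u : K).
Hypothesis liftK : cancel lift f.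
Hypothesis inj_f_u : forall x, f (u * x) = 0 -> u * x = 0.

Lemma dvdmx_map_inj m n (X Y : 'M[K]_(m, n)) :
  dvdmx u X -> dvdmx u Y -> map_mx f X = map_mx f Y -> X = Y.
Proof.
move=> [M ->] [N ->] eqf; apply/eqP; rewrite -subr_eq0 -scalerBr; apply/eqP.
apply/matrixP => a b; rewrite !mxE; apply: inj_f_u.
have /matrixP/(_ a b) := eqf; rewrite !mxE => eqab.
by rewrite mulrBr rmorphB /= eqab subrr.
Qed.

(** Multiplying arbitrary lifts of $R$ and $S$ by a power of $A$ that is
    divisible by $u$ makes all the equations checkable after applying $f$. *)
Lemma shift_equivalent_lift m n (A : 'M[K]_m) (B : 'M[K]_n) (p q : {poly K}) :
    det_1_sub_t A = 1 + u *: p -> det_1_sub_t B = 1 + u *: q ->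
  shift_equivalent (map_mx f A) (map_mx f B) -> shift_equivalent A B.
Proof.
move=> /expmx_dvd_of_det[i Ai] /expmx_dvd_of_det[j Bj].
move=> [l [R [S [l_gt0 RS SR AR SA]]]].
pose k := (i + j)%N.
have Ak e : (k <= e)%N -> dvdmx u (A ^+ e).
  by move=> le_ke; apply: dvdmx_expr_le Ai; apply: leq_trans le_ke; apply: leq_addr.
have Bk e : (k <= e)%N -> dvdmx u (B ^+ e).
  by move=> le_ke; apply: dvdmx_expr_le Bj; apply: leq_trans le_ke; apply: leq_addl.
have fliftE p1 p2 (X : 'M[L]_(p1, p2)) : map_mx f (map_mx lift X) = X.
  by apply/matrixP => a b; rewrite !mxE liftK.
have le_k : (k <= k + l + k)%N by rewrite leq_addl.
have AkR e : map_mx f A ^+ e *m R = R *m map_mx f B ^+ e.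
  elim: e => [|e IHe]; first by rewrite !expr0 mul1mx mulmx1.
  by rewrite !exprS -mulmxA IHe !mulmxA AR.
have comA e : map_mx f A *m map_mx f A ^+ e = map_mx f A ^+ e *m map_mx f A.
  by apply: commrX.
exists (k + l + k)%N, (A ^+ k *m map_mx lift R), (map_mx lift S *m A ^+ k).
have dAR : dvdmx u (A ^+ k *m map_mx lift R) by apply/dvdmx_mulr/Ak.
have dSA : dvdmx u (map_mx lift S *m A ^+ k) by apply/dvdmx_mull/Ak.
split; first by rewrite addn_gt0 addn_gt0 l_gt0 orbT.
- apply: dvdmx_map_inj; [exact: Ak | exact: dvdmx_mulr |].
  rewrite !map_mxM !map_mxXn !fliftE !exprD RS.
  by rewrite -[_ * _ * _]/(_ *m _ *m _) !mulmxA.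
- apply: dvdmx_map_inj; [exact: Bk | exact: dvdmx_mulr |].
  rewrite !map_mxM !map_mxXn !fliftE -!mulmxA AkR [X in S *m X]mulmxA AkR.
  rewrite !mulmxA -SR -!mulmxA -[_ *m _]/(_ * (_ * _)) -!exprD.
  by congr (_ ^+ _); rewrite addnAC addnC addnA.
- apply: dvdmx_map_inj; [exact: dvdmx_mull | exact: dvdmx_mulr |].
  by rewrite !map_mxM !map_mxXn !fliftE mulmxA comA -!mulmxA AR.
- apply: dvdmx_map_inj; [exact: dvdmx_mulr | exact: dvdmx_mull |].
  by rewrite !map_mxM !map_mxXn !fliftE mulmxA -SA -!mulmxA comA.
Qed.

End Lifting.

Section GroupRingNorm.
Variable gT : finGroupType.

Lemma ZGcoef_u g : ZGcoef (ZGu gT) g = 1.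
Proof.
have coef_sum (r : seq gT) (F : gT -> ZG gT) :
    ZGcoef (\sum_(h <- r) F h) g = \sum_(h <- r) ZGcoef (F h) g.
  by elim/big_rec2: _ => [|h x y _ <-]; rewrite ffunE.
rewrite /ZGu coef_sum (bigD1 g) //= big1 => [|h ngh]; rewrite ffunE.
  by rewrite eqxx addr0.
by rewrite eq_sym (negPf ngh).
Qed.

Lemma ZGcoef_u_mul x g : ZGcoef (ZGu gT * x) g = ZGaug x.
Proof.
rewrite ffunE /ZGaug [RHS](reindex_inj (mulIg g)) [RHS](reindex_inj invg_inj).
by apply: eq_bigr => h _; rewrite ZGcoef_u mul1r.
Qed.

(** The augmentation of $ux$ is $|G|$ times that of $x$, and $|G|\neq 0$. *)
Lemma ZGaug_inj_u x : ZGaug (ZGu gT * x) = 0 -> ZGu gT * x = 0.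
Proof.
rewrite {1}/ZGaug; under eq_bigr do rewrite ZGcoef_u_mul.
rewrite sumr_const => /eqP; rewrite mulrn_eq0 => /orP[|/eqP augx].
  by move=> /eqP/card0_eq/(_ 1%g).
by apply: ZGP => g; rewrite ZGcoef_u_mul augx ffunE.
Qed.

Lemma in_ZuE (p : {poly ZG gT}) : in_Zu p -> exists q, p = 1 + ZGu gT *: q.
Proof.
move=> [k [c ->]]; exists (\sum_(1 <= i < k.+1) (c i)%:~R *: 'X^i).
rewrite scaler_sumr; congr (_ + _); apply: eq_bigr => i _.
by rewrite scalerA mulrzr.
Qed.

End GroupRingNorm.

Theorem proposition4p6 (gT : finGroupType) (abG : abelian [set: gT])
    (m n : nat) (A : 'M[ZG gT]_m) (B : 'M[ZG gT]_n)
    (hA : in_Zu (det_1_sub_t A)) (hB : in_Zu (det_1_sub_t B))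
    (hAB : shift_equivalent (map_mx (@ZGaug gT) A) (map_mx (@ZGaug gT) B)) :
  shift_equivalent A B.
Proof.
have [p pA] := in_ZuE hA; have [q qB] := in_ZuE hB.
(* The group ring becomes a commutative ring only under the hypothesis abG. *)
pose comZG := GRing.PzRing_hasCommutativeMul.Build (ZG gT) (ZGmulC abG).
pose K : comNzRingType := HB.pack (ZG gT) comZG.
exact: (@shift_equivalent_lift K int (@ZGaug gT) intr (ZGu gT)
  (fun c => etrans (rmorph_int _ c) (intz c)) (@ZGaug_inj_u gT) m n A B p q).
Qed.
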